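(* Let $(\mathfrak{g}_1,J_1,k_1)$ and $(\mathfrak{g}_2,J_2,k_2)$ be two Hermitian Lie algebras with Lee forms $\theta_1$ and $\theta_2$, and let $\rho_1:\mathfrak{g}_1\to \mathrm{Der}(\mathfrak{g}_2)$ and $\rho_2:\mathfrak{g}_2\to\mathrm{Der}(\mathfrak{g}_1)$ form a representation compatible couple such that $\rho_1(x)$ commutes with $J_2$ for all $x\in\mathfrak{g}_1$ and $\rho_2(a)$ commutes with $J_1$ for all $a\in\mathfrak{g}_2$. Let $(\mathfrak{g}_{(\rho_1,\rho_2)},J,K)$ be the associated Hermitian twisted cartesian product. Then its Lee form $\theta$ is given by $$\theta(x)=\theta_1(x)-\mathcal{X}_{\rho_1}(x),\quad x\in\mathfrak{g}_1,\qquad\qquad \theta(a)=\theta_2(a)-\mathcal{X}_{\rho_2}(a),\quad a\in\mathfrak{g}_2,$$ where $\mathcal{X}_{\rho_1}(x)=\mathrm{tr}(\rho_1(x))$ (trace of an endomorphism of $\mathfrak{g}_2$) and $\mathcal{X}_{\rho_2}(a)=\mathrm{tr}(\rho_2(a))$ (trace of an endomorphism of $\mathfrak{g}_1$). Moreover, $(\mathfrak{g}_{(\rho_1,\rho_2)},J,K)$ is: (i) balanced if and only if $\theta_1(x)=\mathcal{X}_{\rho_1}(x)$ and $\theta_2(a)=\mathcal{X}_{\rho_2}(a)$ for all $x\in\mathfrak{g}_1$ and $a\in\mathfrak{g}_2$; (ii) locally conformally balanced (LCB) if and only if $(\mathfrak{g}_1,J_1,k_1)$ and $(\mathfrak{g}_2,J_2,k_2)$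 are both LCB and $$\theta_1\big(\rho_2(a)x\big)-\theta_2\big(\rho_1(x)a\big)=\mathcal{X}_{\rho_1}\big(\rho_2(a)x\big)-\mathcal{X}_{\rho_2}\big(\rho_1(x)a\big)$$ for all $x\in\mathfrak{g}_1$ and $a\in\mathfrak{g}_2$.
   Context: All Lie algebras are real and finite-dimensional. A Hermitian Lie algebra $(\mathfrak{g},J,k)$ is a Lie algebra $\mathfrak{g}$ with an endomorphism $J$, $J^2=-\mathrm{Id}$, that is integrable (the Nijenhuis tensor $N_J(u,v)=[Ju,Jv]-[u,v]-J([Ju,v]+[u,Jv])$ vanishes), and a scalar product (positive definite) $k$ with $k(J\cdot,J\cdot)=k(\cdot,\cdot)$. Its fundamental form is $\omega(u,v)=k(Ju,v)$. Its Lee form is $\theta=-d^*\omega\circ J$, where $d^*\omega(X)=-\sum_i(\nabla_{u_i}\omega)(u_i,X)$ for an orthonormal basis $(u_i)$ of $\mathfrak{g}$, and $\nabla$ is the Levi-Civita product of $(\mathfrak g,k)$, i.e. $2k(\nabla_uv,w)=k([u,v],w)-k([v,w],u)-k([u,w],v)$, with $(\nabla_u\omega)(v,w)=-\omega(\nabla_uv,w)-\omega(v,\nabla_uw)$. The structure is called balanced if $\theta=0$, and locally conformally balanced (LCB) if $d\theta=0$, where $d\theta(u,v)=-\theta([u,v])$. $\mathrm{Der}(\mathfrak{g})$ is the Lie algebra of derivations of $\mathfrak{g}$. Two Lie algebra representations $\rho_1:\mathfrak{g}_1\to\mathrm{Der}(\mathfrak{g}_2)$, $\rho_2:\mathfrak{g}_2\to\mathrm{Der}(\mathfrak{g}_1)$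 form a representation compatible couple $(\rho_1,\rho_2)$ if $$\rho_1(\rho_2(a)x)b=\rho_1(\rho_2(b)x)a,\qquad \rho_2(\rho_1(x)a)y=\rho_2(\rho_1(y)a)x$$ for all $x,y\in\mathfrak{g}_1$, $a,b\in\mathfrak{g}_2$. The twisted cartesian product $\mathfrak{g}_{(\rho_1,\rho_2)}$ is then the Lie algebra with underlying space $\mathfrak{g}_1\oplus\mathfrak{g}_2$ and bracket $[x,y]=[x,y]_1$, $[a,b]=[a,b]_2$, $[x,a]=\rho_1(x)a-\rho_2(a)x$ for $x,y\in\mathfrak{g}_1$, $a,b\in\mathfrak{g}_2$. It is equipped with $K(x+a,y+b)=k_1(x,y)+k_2(a,b)$ and $J(x+a)=J_1x+J_2a$. When $\rho_1(x)$ commutes with $J_2$ and $\rho_2(a)$ commutes with $J_1$ for all $x\in\mathfrak{g}_1,a\in\mathfrak{g}_2$, $(\mathfrak{g}_{(\rho_1,\rho_2)},J,K)$ is a Hermitian Lie algebra, called the Hermitian twisted cartesian product. *)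

(* Defs.v *)
From HB Require Import structures.
From mathcomp Require Import all_boot all_order all_algebra.
From mathcomp Require Import reals ring.

Set Implicit Arguments.
Unset Strict Implicit.
Unset Printing Implicit Defensive.

Import Order.TTheory GRing.Theory Num.Theory.
Local Open Scope ring_scope.

Record lieAlgebra (R : realType) := LieAlgebra {
  lie_carrier :> vectType R;
  bracket : {bilinear lie_carrier -> lie_carrier -> lie_carrier};
  bracket_alt : forall u, bracket u u = 0;
  bracket_jacobi : forall u v w,
    bracket u (bracket v w) + bracket v (bracket w u)
    + bracket w (bracket u v) = 0 }.
Arguments bracket {R l}.

Definition nijenhuis (R : realType) (g : lieAlgebra R) (J : 'End(g))
    (u v : g) : g :=
  bracket (J u) (J v) - bracket u v - J (bracket (J u) v + bracket u (J v)).

Record hermitianLie (R : realType) := HermitianLie {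
  herm_lie :> lieAlgebra R;
  complex_str : 'End(herm_lie);
  metric : {dot herm_lie for idfun};
  complex_strK : forall u, complex_str (complex_str u) = - u;
  complex_str_integrable : forall u v, nijenhuis complex_str u v = 0;
  metric_compatible : forall u v,
    metric (complex_str u) (complex_str v) = metric u v }.
Arguments complex_str {R} h.
Arguments metric {R} h.

Section OrthonormalBasis.
Variables (R : realType) (V : vectType R) (k : {dot V for idfun}).

Definition is_orthonormal_basis (e : (\dim {:V}).-tuple V) : bool :=
  basis_of {:V} e && orthonormal k e.

Lemma dotC u v : k u v = k v u.
Proof. by rewrite hermC expr0 mul1r. Qed.

Lemma orthonormal_nth (s : seq V) : orthonormal k s ->
  forall i j, (i < size s)%N -> (j < size s)%N -> k s`_i s`_j = (i == j)%:R.
Proof.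
elim: s => [//|v s IHs] /andP[/=/andP[/eqP v1 s1]] /andP[].
rewrite /ortho_rec /= andbT => /allP vs ps [|i] [|j] //= lti ltj.
- by rewrite (eqP (vs _ (mem_nth 0 _))).
- by rewrite dotC (eqP (vs _ (mem_nth 0 _))).
- by rewrite IHs // /orthonormal s1.
Qed.

Lemma gram_schmidt (X : seq V) : free X ->
  exists2 s, orthonormal k s & size s = size X /\ <<s>>%VS = <<X>>%VS.
Proof.
elim: X => [_|v X IHX]; first by exists [::].
rewrite free_cons => /andP[vX /IHX[s os [sz sp]]].
pose w := v - \sum_(i < size s) k v s`_i *: s`_i.
have sumin : \sum_(i < size s) k v s`_i *: s`_i \in <<s>>%VS.
  by apply: memv_suml => i _; rewrite memvZ // memv_span // mem_nth.
have w0 : w != 0.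
  apply: contra vX; rewrite subr_eq0 -sp => /eqP ->; exact: sumin.
have kw : 0 < k w w by exact: neq0_dnorm_gt0.
have kws (j : 'I_(size s)) : k w s`_j = 0.
  rewrite /w linearBl linear_sumlz (bigD1 j) //= big1 => [|i ij].
    by rewrite linearZl_LR /= orthonormal_nth // eqxx mulr1 addr0 subrr.
  by rewrite linearZl_LR /= orthonormal_nth // val_eqE (negbTE ij) mulr0.
pose c := (Num.sqrt (k w w))^-1.
have sq0 : Num.sqrt (k w w) != 0 by rewrite gt_eqF ?sqrtr_gt0.
have c0 : c != 0 by rewrite invr_eq0.
exists (c *: w :: s).
  case/andP: os => s1 ps; rewrite /orthonormal /= s1 ps !andbT /=.
  have cc : c * (c * k w w) = 1.
    by rewrite -[k w w in LHS](sqr_sqrtr (ltW kw)) /c; field.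
  rewrite linearZl_LR linearZr_LR /= cc.
  rewrite eqxx /=; apply/allP => x /(nthP 0)[i lti <-] /=.
  by rewrite linearZl_LR /= (kws (Ordinal lti)) mulr0.
split=> /=; first by rewrite sz.
rewrite !span_cons sp; apply/eqP; rewrite eqEsubv !subv_add !addvSr !andbT.
rewrite -!memvE; apply/andP; split.
  by rewrite memvZ // memv_add ?memv_line // memvN -sp.
have -> : v = c^-1 *: (c *: w) + \sum_(i < size s) k v s`_i *: s`_i.
  by rewrite scalerA mulVf // scale1r subrK.
by apply: memv_add; [exact/memvZ/memv_line | rewrite -sp].
Qed.

Lemma exists_orthonormal_basis : exists e, is_orthonormal_basis e.
Proof.
have /andP[/eqP spX frX] := vbasisP {:V}.
have [s os [sz sp]] := gram_schmidt frX.
have szs : size s == \dim {:V} by rewrite sz size_tuple.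
exists (Tuple szs); rewrite /is_orthonormal_basis os andbT /=.
by rewrite basisEdim sp spX subvv /= (eqP szs).
Qed.

Definition orthonormal_basis : (\dim {:V}).-tuple V :=
  xchoose exists_orthonormal_basis.

Lemma orthonormal_basisP : is_orthonormal_basis orthonormal_basis.
Proof. exact: xchooseP. Qed.

Lemma orthonormal_expansion e v : is_orthonormal_basis e ->
  v = \sum_(i < \dim {:V}) k v e`_i *: e`_i.
Proof.
case/andP=> be oe; rewrite [LHS](coord_basis be) ?memvf //.
apply: eq_bigr => i _; congr (_ *: _).
rewrite [in RHS](coord_basis be (memvf v)) linear_sumlz (bigD1 i) //= big1.
  by rewrite linearZl_LR /= orthonormal_nth ?size_tuple // eqxx mulr1 addr0.
move=> j ji; rewrite linearZl_LR /= orthonormal_nth ?size_tuple //.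
by rewrite val_eqE (negbTE ji) mulr0.
Qed.

Lemma sum_orthonormal (B : {biscalar V}) e f :
  is_orthonormal_basis e -> is_orthonormal_basis f ->
  \sum_(i < \dim {:V}) B e`_i e`_i = \sum_(i < \dim {:V}) B f`_i f`_i.
Proof.
move=> ONe ONf.
transitivity (\sum_(i < \dim {:V}) \sum_(j < \dim {:V})
    k e`_i f`_j * B f`_j e`_i).
  apply: eq_bigr => i _; rewrite {1}[e`_i](orthonormal_expansion _ ONf).
  by rewrite linear_sumlz; apply: eq_bigr => j _; rewrite linearZl_LR.
rewrite exchange_big; apply: eq_bigr => j _ /=.
rewrite [X in _ = B _ X](orthonormal_expansion _ ONe) linear_sumr.
by apply: eq_bigr => i _; rewrite linearZr_LR /= dotC.
Qed.

End OrthonormalBasis.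

Section LeeForm.
Variables (R : realType) (g : hermitianLie R).
Implicit Types u v w X : g.
Local Notation k := (metric g).
Local Notation J := (complex_str g).
Local Notation e := (orthonormal_basis k).

Definition koszul u v w : R :=
  k (bracket u v) w - k (bracket v w) u - k (bracket u w) v.

(* The solution of the Koszul equation, written in an orthonormal basis;
   nablaP and nabla_unique show that it is the Levi-Civita product. *)
Definition nabla u v : g :=
  \sum_(i < \dim {:g}) (koszul u v e`_i / 2%:R) *: e`_i.

Definition fundamental_form u v : R := k (J u) v.

Definition nabla_form u v w : R :=
  - fundamental_form (nabla u v) w - fundamental_form v (nabla u w).

Definition codiff X : R :=
  - \sum_(i < \dim {:g}) nabla_form e`_i e`_i X.

Definition lee_form X : R := - codiff (J X).

(* Exterior derivative of a 1-form. *)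
Definition ext_d (alpha : g -> R) u v : R := - alpha (bracket u v).

Definition balanced : Prop := forall u, lee_form u = 0.
Definition lc_balanced : Prop := forall u v, ext_d lee_form u v = 0.

Lemma nablaP u v w : 2%:R * k (nabla u v) w = koszul u v w.
Proof.
have ew := orthonormal_expansion w (orthonormal_basisP k).
rewrite /nabla linear_sumlz mulr_sumr.
transitivity (\sum_(i < \dim {:g}) k w e`_i * koszul u v e`_i).
  apply: eq_bigr => i _; rewrite linearZl_LR /= (dotC k w); by field.
rewrite [w in RHS]ew /koszul !linear_sumr linear_sumlz -!sumrB.
rewrite linear_sumlz -sumrB; apply: eq_bigr => i _.
by rewrite !linearZr_LR !linearZl_LR /= -!mulrBr.
Qed.

Lemma nabla_unique u v t :
  (forall w, 2%:R * k t w = koszul u v w) -> t = nabla u v.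
Proof.
move=> tP; apply/eqP; rewrite -subr_eq0; apply: contraTT isT => /= d0.
have := neq0_dnorm_gt0 (s := k) _ d0.
set d := {2}(t - _) in d0 *.
have kd : k t d = k (nabla u v) d.
  by apply: (mulfI (_ : 2%:R != 0 :> R)); rewrite ?pnatr_eq0 // tP nablaP.
by rewrite linearBl /= kd subrr ltxx.
Qed.

Lemma nabla_linearl v : linear (nabla^~ v).
Proof.
move=> a u u'; apply/esym/nabla_unique => w.
rewrite linearPl /= mulrDr mulrCA !nablaP /koszul.
by rewrite !linearPl !linearPr /=; ring.
Qed.

Lemma nabla_linearr u : linear (nabla u).
Proof.
move=> a v v'; apply/esym/nabla_unique => w.
rewrite linearPl /= mulrDr mulrCA !nablaP /koszul.
by rewrite !linearPr /= !linearPl /=; ring.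
Qed.

Lemma nabla_form_bilinear X :
  bilinear_for *%R *%R (fun u v => nabla_form u v X).
Proof.
split=> w a u v; rewrite /nabla_form /fundamental_form.
  by rewrite !nabla_linearl !linearP /= !linearPl /=; ring.
by rewrite nabla_linearr !linearP /= !linearPl /=; ring.
Qed.

(* The codifferential does not depend on the orthonormal basis. *)
Lemma codiffE (f : (\dim {:g}).-tuple g) X : is_orthonormal_basis k f ->
  codiff X = - \sum_(i < \dim {:g}) nabla_form f`_i f`_i X.
Proof.
move=> ONf; congr (- _).
pose B : {biscalar g} := HB.pack (fun u v => nabla_form u v X)
  (bilinear_isBilinear.Build _ _ _ _ _ _ _ (nabla_form_bilinear X)).
exact: (sum_orthonormal B (orthonormal_basisP k) ONf).
Qed.

End LeeForm.

(* Linear identities between vectors are checked on coordinates in the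
   canonical basis, where the ring tactic applies. *)
Section Coordinates.
Import VectorInternalTheory.
Variables (R : realType) (V : vectType R).

Definition vcoord (i : 'I_(dim V)) (v : V) : R :=
  v2r v 0 i.

Lemma vcoordD i u v : vcoord i (u + v) = vcoord i u + vcoord i v.
Proof. by rewrite /vcoord linearD mxE. Qed.

Lemma vcoordN i u : vcoord i (- u) = - vcoord i u.
Proof. by rewrite /vcoord linearN mxE. Qed.

Lemma vcoordZ i c u : vcoord i (c *: u) = c * vcoord i u.
Proof. by rewrite /vcoord linearZ mxE. Qed.

Lemma vcoord0 i : vcoord i 0 = 0.
Proof. by rewrite /vcoord linear0 mxE. Qed.

Lemma vcoord_inj u v : (forall i, vcoord i u = vcoord i v) -> u = v.
Proof.
move=> uv; apply: (can_inj (@v2rK _ _)).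
by apply/rowP => i; exact: uv.
Qed.

End Coordinates.

Ltac vring := apply: vcoord_inj => ?;
  rewrite ?(vcoordD, vcoordN, vcoordZ, vcoord0); ring.

Section TwistedProduct.
Variables (R : realType).

Definition is_derivation (g : lieAlgebra R) (D : 'End(g)) : Prop :=
  forall u v, D (bracket u v) = bracket (D u) v + bracket u (D v).

Definition is_der_representation (g h : lieAlgebra R)
    (rho : 'Hom(g, 'End(h))) : Prop :=
  (forall x, is_derivation (rho x)) /\
  (forall x y,
     rho (bracket x y) = (rho x \o rho y)%VF - (rho y \o rho x)%VF).

Record compatible_couple (g1 g2 : lieAlgebra R)
    (rho1 : 'Hom(g1, 'End(g2))) (rho2 : 'Hom(g2, 'End(g1))) : Prop :=
  CompatibleCouple {
    couple_rep1 : is_der_representation rho1;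
    couple_rep2 : is_der_representation rho2;
    couple_compat1 : forall (x : g1) (a b : g2),
      rho1 (rho2 a x) b = rho1 (rho2 b x) a;
    couple_compat2 : forall (x y : g1) (a : g2),
      rho2 (rho1 x a) y = rho2 (rho1 y a) x }.

Lemma bracketC (g : lieAlgebra R) (u v : g) : bracket u v = - bracket v u.
Proof.
apply/eqP; rewrite -addr_eq0; have := bracket_alt (u + v).
by rewrite linearDl !linearDr !bracket_alt add0r addr0 => ->.
Qed.

Lemma twisted_jacobi_fst (g1 g2 : lieAlgebra R)
    (rho1 : 'Hom(g1, 'End(g2))) (rho2 : 'Hom(g2, 'End(g1))) :
  is_der_representation rho2 ->
  (forall (x y : g1) (a : g2), rho2 (rho1 x a) y = rho2 (rho1 y a) x) ->
  let br (p q : g1 * g2) : g1 * g2 :=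
    (bracket p.1 q.1 - rho2 q.2 p.1 + rho2 p.2 q.1,
     bracket p.2 q.2 - rho1 q.1 p.2 + rho1 p.1 q.2) in
  forall p q r, (br p (br q r) + br q (br r p) + br r (br p q)).1 = 0.
Proof.
move=> [der rep] compat br [x a] [y b] [z c] /=.
rewrite !linearD !linearN /= !rep !(add_lfunE, opp_lfunE, comp_lfunE) !der.
have -> : bracket z (bracket x y) =
    - bracket x (bracket y z) - bracket y (bracket z x).
  by apply/eqP; rewrite -subr_eq0 -(bracket_jacobi x y z); apply/eqP; vring.
rewrite (compat z x b) (compat z y a) (compat y x c).
rewrite (bracketC (rho2 a y)) (bracketC (rho2 b z)) (bracketC (rho2 c x)).
vring.
Qed.

Lemma twisted_nijenhuis_fst (g1 g2 : hermitianLie R)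
    (rho2 : 'Hom(g2, 'End(g1))) (J1 := complex_str g1) (J2 := complex_str g2) :
  (forall (a : g2) (x : g1), rho2 a (J1 x) = J1 (rho2 a x)) ->
  let br (p q : g1 * g2) : g1 :=
    bracket p.1 q.1 - rho2 q.2 p.1 + rho2 p.2 q.1 in
  let Jp (p : g1 * g2) : g1 * g2 := (J1 p.1, J2 p.2) in
  forall p q, br (Jp p) (Jp q) - br p q - J1 (br (Jp p) q + br p (Jp q)) = 0.
Proof.
move=> rJ br Jp [x a] [y b]; rewrite /br /Jp /= !rJ.
rewrite -(complex_str_integrable x y) /nijenhuis -/J1.
rewrite !(linearD J1) !(linearN J1) /= /J1 !complex_strK; vring.
Qed.

Section Bracket.
Variables (g1 g2 : lieAlgebra R).
Variables (rho1 : 'Hom(g1, 'End(g2))) (rho2 : 'Hom(g2, 'End(g1))).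

(* The elements x + a of the direct sum are the pairs (x, a). *)
Definition twisted_bracket (p q : g1 * g2) : g1 * g2 :=
  (bracket p.1 q.1 - rho2 q.2 p.1 + rho2 p.2 q.1,
   bracket p.2 q.2 - rho1 q.1 p.2 + rho1 p.1 q.2).

Lemma twisted_bracket_bilinear : bilinear_for *:%R *:%R twisted_bracket.
Proof.
split=> q c p p'; rewrite /twisted_bracket; congr (_, _);
  rewrite /= ?linearPl ?linearP /= ?add_lfunE ?scale_lfunE; vring.
Qed.

Lemma twisted_bracket11 x y :
  twisted_bracket (x, 0) (y, 0) = (bracket x y, 0).
Proof.
by rewrite /twisted_bracket /= ?linear0 ?linear0l !zero_lfunE !(subr0, addr0).
Qed.

Lemma twisted_bracket22 a b :
  twisted_bracket (0, a) (0, b) = (0, bracket a b).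
Proof.
by rewrite /twisted_bracket /= ?linear0 ?linear0l !zero_lfunE !(subr0, addr0).
Qed.

Lemma twisted_bracket12 x a :
  twisted_bracket (x, 0) (0, a) = (- rho2 a x, rho1 x a).
Proof.
rewrite /twisted_bracket /= ?linear0 ?linear0l.
by rewrite !(subr0, addr0, add0r).
Qed.

HB.instance Definition _ := bilinear_isBilinear.Build R (g1 * g2)%type
  (g1 * g2)%type (g1 * g2)%type *:%R *:%R twisted_bracket
  twisted_bracket_bilinear.

Lemma twisted_bracket_alt p : twisted_bracket p p = 0.
Proof. by rewrite /twisted_bracket !bracket_alt !sub0r !addNr. Qed.

Hypothesis cc : compatible_couple rho1 rho2.

Lemma twisted_bracket_jacobi p q r :
  twisted_bracket p (twisted_bracket q r)
  + twisted_bracket q (twisted_bracket r p)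
  + twisted_bracket r (twisted_bracket p q) = 0.
Proof.
have [r1 r2 c1 c2] := cc.
congr (_, _); first exact: (twisted_jacobi_fst r2 c2).
exact: (twisted_jacobi_fst r1 (fun a b x => c1 x a b)
  (p.2, p.1) (q.2, q.1) (r.2, r.1)).
Qed.

Definition twisted_product : lieAlgebra R :=
  @LieAlgebra R (g1 * g2)%type twisted_bracket
    twisted_bracket_alt twisted_bracket_jacobi.

End Bracket.

Section Hermitian.
Variables (g1 g2 : hermitianLie R).
Variables (rho1 : 'Hom(g1, 'End(g2))) (rho2 : 'Hom(g2, 'End(g1))).
Hypothesis cc : compatible_couple rho1 rho2.
Hypothesis rho1J : forall (x : g1) (a : g2),
  rho1 x (complex_str g2 a) = complex_str g2 (rho1 x a).
Hypothesis rho2J : forall (a : g2) (x : g1),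
  rho2 a (complex_str g1 x) = complex_str g1 (rho2 a x).

Definition prod_complex (p : g1 * g2) : g1 * g2 :=
  (complex_str g1 p.1, complex_str g2 p.2).

Lemma prod_complex_linear : linear prod_complex.
Proof. by move=> c p q; rewrite /prod_complex !linearP. Qed.

HB.instance Definition _ := GRing.isSemilinear.Build R (g1 * g2)%type
  (g1 * g2)%type _ prod_complex (GRing.semilinear_linear prod_complex_linear).

Definition prod_metric (p q : g1 * g2) : R :=
  metric g1 p.1 q.1 + metric g2 p.2 q.2.

Lemma prod_metric_bilinear :
  bilinear_for *%R (idfun \; *%R) prod_metric.
Proof.
by split=> q c p p'; rewrite /prod_metric !(linearPl, linearPr) /=; ring.
Qed.

Lemma prod_metric_sym p q :
  prod_metric p q = (-1) ^+ false * idfun (prod_metric q p).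
Proof. by rewrite expr0 mul1r /prod_metric !(dotC _ p.1, dotC _ p.2). Qed.

Lemma prod_metric_gt0 p : p != 0 -> 0 < prod_metric p p.
Proof.
have ge0 (h : hermitianLie R) (v : h) : 0 <= metric h v v.
  by have [->|/neq0_dnorm_gt0/ltW //] := eqVneq v 0; rewrite linear0l.
case: p => x a; have [->|x0 _] := eqVneq x 0; last first.
  by rewrite /prod_metric ltr_pwDl //; exact: neq0_dnorm_gt0.
have [->|a0 _] := eqVneq a 0; first by rewrite eqxx.
by rewrite /prod_metric ltr_wpDl //; exact: neq0_dnorm_gt0.
Qed.

HB.instance Definition _ := bilinear_isBilinear.Build R (g1 * g2)%type
  (g1 * g2)%type R *%R (idfun \; *%R) prod_metric prod_metric_bilinear.
HB.instance Definition _ := isHermitianSesquilinear.Build R (g1 * g2)%type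
  false idfun prod_metric prod_metric_sym.
HB.instance Definition _ := isDotProduct.Build R (g1 * g2)%type
  prod_metric prod_metric_gt0.

Let J : 'End(twisted_product cc) := linfun prod_complex.

Lemma twisted_complexK (p : twisted_product cc) : J (J p) = - p.
Proof.
by rewrite !lfunE /= /prod_complex /= !complex_strK; case: p.
Qed.

Lemma twisted_complex_integrable (p q : twisted_product cc) :
  nijenhuis J p q = 0.
Proof.
rewrite /nijenhuis !lfunE /=; congr (_, _).
  exact: (twisted_nijenhuis_fst rho2J).
exact: (twisted_nijenhuis_fst rho1J (p.2, p.1) (q.2, q.1)).
Qed.

Lemma twisted_metric_compatible (p q : twisted_product cc) :
  prod_metric (J p) (J q) = prod_metric p q.
Proof. by rewrite !lfunE /prod_metric /= !metric_compatible. Qed.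

Definition hermitian_twisted_product : hermitianLie R :=
  @HermitianLie R (twisted_product cc) J prod_metric
    twisted_complexK twisted_complex_integrable twisted_metric_compatible.

Lemma hermitian_twisted_productE (x : g1) (a : g2) :
  complex_str hermitian_twisted_product (x, a) =
    (complex_str g1 x, complex_str g2 a).
Proof. by rewrite /= lfunE. Qed.

End Hermitian.

Definition lf_trace (V : vectType R) (f : 'End(V)) : R :=
  \tr (passmx.mxof (vbasis {:V}) (vbasis {:V}) f).

End TwistedProduct.

(* Main.v *)
From HB Require Import structures.
Require Import Defs.
From mathcomp Require Import all_boot all_order all_algebra.
From mathcomp Require Import reals ring lra.

Set Implicit Arguments.
Unset Strict Implicit.
Unset Printing Implicit Defensive.

Import Order.TTheory GRing.Theory Num.Theory.
Local Open Scope ring_scope.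

(** The codifferential in the definition of the Lee form is a contraction over
    an orthonormal basis.  Expanding the Levi-Civita product by the Koszul
    formula turns it into a contraction of the bracket alone: in an
    orthonormal basis (u_i),

      theta(X) = - tr (ad X) + 1/2 sum_i k([u_i, J u_i], J X),

    which is lee_form_parseval.  For the twisted product one contracts over
    the union of bases of the two factors.  Each factor is a subalgebra stable
    under J and orthogonal to the other one, so the second term is the sum of
    the second terms of the factors.  In the first term ad (x + a) has diagonal
    blocks ad x + rho2(a) and ad a + rho1(x), and only those contribute to the
    trace.  Hence

      theta(x + a) = (theta1(x) - tr rho1(x)) + (theta2(a) - tr rho2(a)),

    which is lee_form_twisted.  The criterion for balanced products is then
    immediate.  For the closedness of theta, evaluate this formula on brackets:
    traces vanish on rho([x, y]) = [rho(x), rho(y)], so brackets inside a factor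
    only see the differentials of theta1 and theta2, and the mixed brackets
    [x, a] = rho1(x) a - rho2(a) x give the remaining condition. *)

(** * Parseval frames *)

(** Contractions over an orthonormal basis use nothing but the expansion of
    vectors in that basis.  A sequence with this property has no dimension to
    be matched, so that frames of the factors of a product can simply be
    concatenated. *)
Definition parseval (R : realType) (V : vectType R) (k : {dot V for idfun})
    (s : seq V) : Prop :=
  forall v, v = \sum_(u <- s) k v u *: u.

Lemma orthonormal_parseval (R : realType) (V : vectType R)
    (k : {dot V for idfun}) (e : (\dim {:V}).-tuple V) :
  is_orthonormal_basis k e -> parseval k e.
Proof.
move=> ONe v; rewrite [LHS](orthonormal_expansion v ONe).
by rewrite (big_nth 0) big_mkord size_tuple.
Qed.

(** Both sides equal the double sum of k(u, v) B(v, u), with u ranging over one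
    frame and v over the other. *)
Lemma parseval_contraction (R : realType) (V : vectType R)
    (k : {dot V for idfun}) (B : V -> V -> R) (s t : seq V) :
  bilinear_for *%R *%R B -> parseval k s -> parseval k t ->
  \sum_(u <- s) B u u = \sum_(u <- t) B u u.
Proof.
move=> Bbil ks kt.
pose C : {biscalar V} := HB.pack B
  (bilinear_isBilinear.Build _ _ _ _ _ _ _ Bbil).
rewrite -[B]/(C : V -> V -> R).
transitivity (\sum_(u <- s) \sum_(v <- t) k u v * C v u).
  apply: eq_bigr => u _; rewrite {1}(kt u) linear_sumlz.
  by apply: eq_bigr => v _; rewrite linearZl_LR.
rewrite exchange_big; apply: eq_bigr => v _ /=.
rewrite [X in _ = C _ X](ks v) linear_sumr.
by apply: eq_bigr => u _; rewrite linearZr_LR /= dotC.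
Qed.

Lemma lf_traceE (R : realType) (V : vectType R) (f : 'End(V))
    (b := vbasis {:V}) :
  lf_trace f = \sum_(i < \dim {:V}) coord b i (f b`_i).
Proof.
rewrite /lf_trace /mxtrace; apply: eq_bigr => i _.
by rewrite !mxE /= passmx.vecof_delta.
Qed.

Lemma lf_trace_parseval (R : realType) (V : vectType R)
    (k : {dot V for idfun}) (s : seq V) (f : 'End(V)) :
  parseval k s -> lf_trace f = \sum_(u <- s) k (f u) u.
Proof.
move=> ks; rewrite lf_traceE; set b := vbasis {:V}.
transitivity (\sum_(i < \dim {:V}) \sum_(u <- s) k (f b`_i) u * coord b i u).
  apply: eq_bigr => i _; rewrite {1}(ks (f b`_i)) linear_sum.
  by apply: eq_bigr => u _; rewrite linearZ.
rewrite exchange_big; apply: eq_bigr => u _ /=.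
rewrite {3}(coord_basis (vbasisP {:V}) (memvf u)) linear_sum linear_sumlz.
by apply: eq_bigr => i _; rewrite linearZ linearZl_LR mulrC.
Qed.

Lemma lf_traceB (R : realType) (V : vectType R) (f h : 'End(V)) :
  lf_trace (f - h) = lf_trace f - lf_trace h.
Proof.
rewrite !lf_traceE -sumrB; apply: eq_bigr => i _.
by rewrite add_lfunE opp_lfunE linearB.
Qed.

Lemma lf_trace_commutator (R : realType) (V : vectType R) (f h : 'End(V)) :
  lf_trace ((f \o h)%VF - (h \o f)%VF) = 0.
Proof.
have b := vbasisP {:V}.
rewrite lf_traceB /lf_trace !(passmx.mxof_comp _ _ b).
by rewrite mxtrace_mulC subrr.
Qed.

Lemma lf_trace_rep_bracket (R : realType) (g h : lieAlgebra R)
    (rho : 'Hom(g, 'End(h))) (x y : g) :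
  is_der_representation rho -> lf_trace (rho (bracket x y)) = 0.
Proof. by case=> _ ->; exact: lf_trace_commutator. Qed.

(** * The Lee form in terms of the bracket *)

Section LeeFormBracket.
Variables (R : realType) (g : hermitianLie R).
Local Notation k := (metric g).
Local Notation J := (complex_str g).

(** J is an isometry, so it maps frames to frames. *)
Lemma complex_parseval (s : seq g) :
  parseval k s -> parseval k (map J s).
Proof.
move=> ks v; rewrite big_map -[LHS]opprK -(complex_strK v) (ks (J v)).
rewrite linear_sum -sumrN; apply: eq_bigr => u _.
rewrite linearZ -scaleNr; congr (_ *: _).
by rewrite -[RHS]metric_compatible complex_strK linearNr.
Qed.

(** Replacing the frame by its image under J turns the first sum into the
    opposite of the second.  Since k(u, J v) = - k(J u, v), the identity is
    tr (ad X o J) = tr (J o ad X). *)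
Lemma sum_bracket_complex (s : seq g) (X : g) :
  parseval k s ->
  \sum_(u <- s) (k (bracket X u) (J u) + k (bracket X (J u)) u) = 0.
Proof.
move=> ks; rewrite big_split /=.
pose B (u v : g) := k (bracket X u) (J v).
have Bbil : bilinear_for *%R *%R B.
  split=> w c u v; rewrite /B; first by rewrite linearPr linearPl.
  by rewrite linearP /= linearPr.
rewrite -/(B _ _) (parseval_contraction Bbil ks (complex_parseval ks)).
rewrite big_map -big_split big1 //= => u _.
by rewrite /B complex_strK linearNr addNr.
Qed.

Lemma nablaE (u v w : g) :
  k (nabla u v) w = koszul u v w / 2%:R.
Proof. by rewrite -nablaP; field. Qed.

(** Since theta(X) is minus the codifferential of omega at J X, it is the sum
    of the (nabla_u omega)(u, J X); the Koszul formula makes this the summand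
    below plus half of k([J X, u], J u) + k([J X, J u], u), and these extra
    terms cancel in the sum over the frame. *)
Lemma lee_form_parseval (s : seq g) (X : g) :
  parseval k s ->
  lee_form X =
    \sum_(u <- s) (k (bracket u (J u)) (J X) / 2%:R - k (bracket X u) u).
Proof.
move=> ks; have ke := orthonormal_parseval (orthonormal_basisP k).
pose B (u v : g) := k (bracket u (J v)) (J X) / 2%:R - k (bracket X u) v.
have Bbil : bilinear_for *%R *%R B.
  by split=> w c u v; rewrite /B ?(linearP J) !(linearPl, linearPr) /=; field.
rewrite -/(B _ _) (parseval_contraction Bbil ks ke).
rewrite /lee_form /codiff opprK.
have /(congr1 ( *%R^~ 2%:R^-1)) := sum_bracket_complex (J X) ke.
rewrite mul0r mulr_suml => rot.
rewrite -[RHS]addr0 -[Z in _ = _ + Z]rot -big_split /=.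
rewrite [RHS](big_nth 0) big_mkord size_tuple; apply: eq_bigr => i _.
move: (_`_i) => u; rewrite /nabla_form /fundamental_form.
rewrite metric_compatible (dotC k (J u)) !nablaE /koszul.
rewrite bracket_alt linear0l (bracketC u X) (bracketC u (J X)) !linearNl /=.
by rewrite /B; field.
Qed.

Lemma lee_formB (X Y : g) : lee_form (X - Y) = lee_form X - lee_form Y.
Proof.
have ke := orthonormal_parseval (orthonormal_basisP k).
rewrite !(lee_form_parseval _ ke) -sumrB; apply: eq_bigr => u _.
rewrite (linearB J) linearBr !linearBl /=; ring.
Qed.

End LeeFormBracket.

(** * The Lee form of a twisted product *)

Section TwistedLeeForm.
Variables (R : realType) (g1 g2 : hermitianLie R).
Variables (rho1 : 'Hom(g1, 'End(g2))) (rho2 : 'Hom(g2, 'End(g1))).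
Hypothesis cc : compatible_couple rho1 rho2.
Hypothesis rho1J : forall (x : g1) (a : g2),
  rho1 x (complex_str g2 a) = complex_str g2 (rho1 x a).
Hypothesis rho2J : forall (a : g2) (x : g1),
  rho2 a (complex_str g1 x) = complex_str g1 (rho2 a x).
Let G := hermitian_twisted_product cc rho1J rho2J.

Lemma twisted_parseval (s : seq g1) (t : seq g2) :
  parseval (metric g1) s -> parseval (metric g2) t ->
  parseval (metric G)
    ([seq (x, 0) : G | x <- s] ++ [seq (0, a) : G | a <- t]).
Proof.
move=> ks kt [x a]; rewrite big_cat !big_map /=.
have sum1 : \sum_(y <- s) metric G (x, a) (y, 0) *: ((y, 0) : G) = (x, 0).
  rewrite [in RHS](ks x) (big_morph (fun y => (y, 0) : G) (op1 := +%R)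
    (id1 := 0)) // => [|y z]; last by congr (_, _); rewrite addr0.
  apply: eq_bigr => y _; congr (_, _); last by rewrite scaler0.
  by rewrite /= /prod_metric /= linear0r addr0.
have sum2 : \sum_(b <- t) metric G (x, a) (0, b) *: ((0, b) : G) = (0, a).
  rewrite [in RHS](kt a) (big_morph (fun b => (0, b) : G) (op1 := +%R)
    (id1 := 0)) // => [|b c]; last by congr (_, _); rewrite addr0.
  apply: eq_bigr => b _; congr (_, _); first by rewrite scaler0.
  by rewrite /= /prod_metric /= linear0r add0r.
by rewrite sum1 sum2; congr (_, _); rewrite /= ?addr0 ?add0r.
Qed.

(** A frame vector (u, 0) gives [(u, 0), J (u, 0)] = ([u, J1 u], 0), and the
    first component of [(x, a), (u, 0)] is [x, u] + rho2(a) u.  So the frame of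
    the first factor contributes theta1(x) - tr rho2(a), and the other one
    contributes theta2(a) - tr rho1(x). *)
Lemma lee_form_twisted (x : g1) (a : g2) :
  lee_form (g := G) (x, a) =
    (lee_form x - lf_trace (rho1 x)) + (lee_form a - lf_trace (rho2 a)).
Proof.
have ks := orthonormal_parseval (orthonormal_basisP (metric g1)).
have kt := orthonormal_parseval (orthonormal_basisP (metric g2)).
move: (tval _) (tval _) ks kt => s t ks kt.
rewrite (lee_form_parseval _ (twisted_parseval ks kt)) big_cat !big_map /=.
rewrite (lee_form_parseval _ ks) (lee_form_parseval _ kt).
rewrite (lf_trace_parseval _ ks) (lf_trace_parseval _ kt).
rewrite addrACA [- _ - _]addrC addrACA -!sumrB.
congr (_ + _); apply: eq_bigr => u _.
  rewrite !lfunE /= /prod_complex /prod_metric /=.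
  rewrite !(linear0, linear0l, zero_lfunE, addr0, subr0, add0r).
  by rewrite linearDl /=; ring.
rewrite !lfunE /= /prod_complex /prod_metric /=.
rewrite !(linear0, linear0l, zero_lfunE, addr0, subr0, add0r).
by rewrite linearDl /=; ring.
Qed.

End TwistedLeeForm.


Theorem theorem2p1 (R : realType) (g1 g2 : hermitianLie R)
    (rho1 : 'Hom(g1, 'End(g2))) (rho2 : 'Hom(g2, 'End(g1)))
    (cc : compatible_couple rho1 rho2)
    (rho1J : forall (x : g1) (a : g2),
       rho1 x (complex_str g2 a) = complex_str g2 (rho1 x a))
    (rho2J : forall (a : g2) (x : g1),
       rho2 a (complex_str g1 x) = complex_str g1 (rho2 a x)) :
  let G := hermitian_twisted_product cc rho1J rho2J in
  [/\ (forall x : g1,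
         lee_form (g := G) (x, 0) = lee_form x - lf_trace (rho1 x)) /\
      (forall a : g2,
         lee_form (g := G) (0, a) = lee_form a - lf_trace (rho2 a)),
      balanced G <->
        (forall x : g1, lee_form x = lf_trace (rho1 x)) /\
        (forall a : g2, lee_form a = lf_trace (rho2 a)) &
      lc_balanced G <->
        [/\ lc_balanced g1, lc_balanced g2 &
          forall (x : g1) (a : g2),
            lee_form (rho2 a x) - lee_form (rho1 x a) =
            lf_trace (rho1 (rho2 a x)) - lf_trace (rho2 (rho1 x a))]].
Proof.
move=> G.
(* The restrictions of the Lee form of G to the two factors. *)
pose l1 (x : g1) := lee_form x - lf_trace (rho1 x).
pose l2 (a : g2) := lee_form a - lf_trace (rho2 a).
have l1B x y : l1 (x - y) = l1 x - l1 y.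
  by rewrite /l1 lee_formB linearB lf_traceB; ring.
have l2B a b : l2 (a - b) = l2 a - l2 b.
  by rewrite /l2 lee_formB linearB lf_traceB; ring.
have l10 : l1 0 = 0 by rewrite -[0 in LHS](subrr 0) l1B subrr.
have l20 : l2 0 = 0 by rewrite -[0 in LHS](subrr 0) l2B subrr.
have leeE x a : lee_form (g := G) (x, a) = l1 x + l2 a.
  exact: lee_form_twisted.
have [rep1 rep2 _ _] := cc.
have l1br x y : l1 (bracket x y) = lee_form (bracket x y).
  by rewrite /l1 lf_trace_rep_bracket // subr0.
have l2br a b : l2 (bracket a b) = lee_form (bracket a b).
  by rewrite /l2 lf_trace_rep_bracket // subr0.
split.
- by split=> [x|a]; rewrite leeE ?l10 ?l20 ?add0r ?addr0.
- split=> [bal|[bal1 bal2] [x a]]; last first.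
    by rewrite leeE /l1 /l2 bal1 bal2 !subrr addr0.
  split=> [x|a]; apply/eqP; rewrite -subr_eq0; apply/eqP.
    by move: (bal (x, 0)); rewrite leeE l20 addr0.
  by move: (bal (0, a)); rewrite leeE l10 add0r.
(* The condition on mixed brackets says that l1 and l2 cancel on [x, a]. *)
- have mixed x a :
      lee_form (rho2 a x) - lee_form (rho1 x a) =
        lf_trace (rho1 (rho2 a x)) - lf_trace (rho2 (rho1 x a)) <->
      l1 (rho2 a x) = l2 (rho1 x a).
    by rewrite /l1 /l2; split=> E; lra.
  split=> [lcb|[lcb1 lcb2 lcbm] [x a] [y b]].
  + split=> [x y|a b|x a].
    * move: (lcb (x, 0) (y, 0)); rewrite /ext_d /= twisted_bracket11 leeE l20.
      by rewrite l1br addr0.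
    * move: (lcb (0, a) (0, b)); rewrite /ext_d /= twisted_bracket22 leeE l10.
      by rewrite l2br add0r.
    * apply/mixed/eqP; rewrite -subr_eq0 -(lcb (x, 0) (0, a)) /ext_d /=.
      rewrite twisted_bracket12 leeE -[- rho2 a x]sub0r l1B l10.
      by apply/eqP; ring.
  + have {}lcbm u c : l1 (rho2 c u) = l2 (rho1 u c) by exact/mixed.
    rewrite /ext_d /= /twisted_bracket /= leeE.
    have subDr (V : zmodType) (p q r : V) : p - q + r = p - (q - r).
      by rewrite opprB addrA addrAC.
    rewrite (subDr g1) (subDr g2) !l1B !l2B l1br l2br !lcbm.
    move: (lcb1 x y) (lcb2 a b); rewrite /ext_d => dxy dab.
    lra.
Qed.
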